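(* Let $(X,\tau_1,\tau_2)$ be a bitopological space and let $i,j\in\{1,2\}$ with $i\neq j$. Then $(X,\tau_1,\tau_2)$ is $(\tau_i,\tau_j)$-nearly Lindelöf if and only if its pairwise semiregularization $(X,\tau^s_{(1,2)},\tau^s_{(2,1)})$ is $(\tau^s_{(i,j)},\tau^s_{(j,i)})$-nearly Lindelöf.
   Context: A bitopological space $(X,\tau_1,\tau_2)$ is a set $X$ with two topologies (no separation axioms assumed). For a topology $\sigma$ on $X$, $\sigma\text{-}\mathrm{int}$ and $\sigma\text{-}\mathrm{cl}$ denote interior and closure with respect to $\sigma$. For $i\ne j$ in $\{1,2\}$, a set $S\subseteq X$ is $(\tau_i,\tau_j)$-regular open if $\tau_i\text{-}\mathrm{int}(\tau_j\text{-}\mathrm{cl}(S))=S$. The topology on $X$ generated by the $(\tau_i,\tau_j)$-regular open sets (they are closed under finite intersections and form a base for it) is denoted $\tau^s_{(i,j)}$; the space $(X,\tau^s_{(1,2)},\tau^s_{(2,1)})$ is the pairwise semiregularization of $(X,\tau_1,\tau_2)$. For two topologies $\sigma,\sigma'$ on $X$, the space is $(\sigma,\sigma')$-nearly Lindelöf if for every cover $\{U_\alpha:\alpha\in\Delta\}$ of $X$ by $\sigma$-open sets there is a countable subset $\{\alpha_n:n\in\mathbb{N}\}$ of $\Delta$ with $X=\bigcup_{n\in\mathbb{N}}\sigma\text{-}\mathrm{int}(\sigma'\text{-}\mathrm{cl}(U_{\alpha_n}))$. *)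

(* Defs.v *)
From HB Require Import structures.
From mathcomp Require Import all_boot all_classical topology.

Set Implicit Arguments.
Unset Strict Implicit.
Unset Printing Implicit Defensive.

Local Open Scope classical_set_scope.

(* A topology on [X] is a term of type [Topological X], so that one carrier can
   bear several topologies; [topOpen s], [topInt s], [topCl s] are the library's
   [open], [interior], [closure] with the topology [s] made explicit. *)
Section topology_explicit.
Context {X : Type}.
Implicit Types s t : Topological X.

Definition topOpen s : set (set X) := @open (Topological.Pack s).
Definition topInt s (A : set X) : set X := @interior (Topological.Pack s) A.
Definition topCl s (A : set X) : set X := @closure (Topological.Pack s) A.

Definition pairwise_regopen s t (A : set X) : Prop := topInt s (topCl t A) = A.

End topology_explicit.

Definition semireg_type (X : Type) (s t : Topological X) : Type := X.

Section semiregularization.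
Context {X : Type} (s t : Topological X).
Local Notation S := (semireg_type s t).

(* Only the choice structure (not the topology) is inherited from [s]. *)
HB.instance Definition _ := Choice.copy S (Topological.Pack s).
HB.instance Definition _ :=
  isSubBaseTopological.Build S [set A : set X | pairwise_regopen s t A] id.

Definition semireg : Topological X := Topological.on S.

End semiregularization.

(* A possibly empty [C] is allowed: this differs from picking a sequence of
   indices only when [I], hence [X], is empty. *)
Definition nearly_lindelof (X : Type) (s t : Topological X) : Prop :=
  forall (I : Type) (U : I -> set X),
    (forall a, topOpen s (U a)) -> \bigcup_a U a = [set: X] ->
    exists C : set I,
      countable C /\ \bigcup_(a in C) topInt s (topCl t (U a)) = [set: X].

(* Main.v *)
Require Import Defs.
From mathcomp Require Import all_boot all_classical topology.

(** Write [s'] and [t'] for the two semiregularizations of [(s, t)].  The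
    theorem holds because, on [s]-open sets, the operator which defines near
    Lindelofness does not see the passage from [(s, t)] to [(s', t')]:

      [s'-int (t'-cl U) = s-int (t-cl U)]    for [U] [s]-open

    ([semireg_int_cl]).  The inner closures agree because the complement of
    [t-cl U] is the [t]-interior of the [s]-closed set [~` U], and the interior
    of a closed set of the other topology is regular open ([regopen_int]);
    so [t-cl U] is not only [t]-closed but [t']-closed.  The outer interiors
    agree because the [s]-interior of the [t]-closed set [t-cl U] is regular
    open, hence [s']-open.

    Both implications then exchange covers.  A cover by [s']-open sets is one
    by [s]-open sets, with the same regularized sets.  A cover by [s]-open sets
    [U a] is replaced by the [s']-open cover [s-int (t-cl (U a))], whose members
    are fixed by regularization, so that the countable subfamily selected for
    it also works for [U]. *)

Set Implicit Arguments.
Unset Strict Implicit.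
Unset Printing Implicit Defensive.

Local Open Scope classical_set_scope.

Section explicit_interior_closure.
Context {X : Type}.
Implicit Types (s t : Topological X) (A B : set X).

Lemma topInt_open s A : topOpen s (topInt s A).
Proof. exact: (@open_interior (Topological.Pack s)). Qed.

Lemma topInt_subset s A : topInt s A `<=` A.
Proof. exact: (@interior_subset (Topological.Pack s)). Qed.

Lemma topInt_maximal s A B : topOpen s A -> A `<=` B -> A `<=` topInt s B.
Proof.
move=> oA sAB.
rewrite -[A in A `<=` _](iffLR (@interior_id (Topological.Pack s) A) oA).
exact: (@interiorS (Topological.Pack s)).
Qed.

Lemma topIntS s A B : A `<=` B -> topInt s A `<=` topInt s B.
Proof. exact: (@interiorS (Topological.Pack s)). Qed.

Lemma topIntC s A : topInt s (~` A) = ~` topCl s A.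
Proof. exact: (@interiorC (Topological.Pack s)). Qed.

Lemma subset_topCl s A : A `<=` topCl s A.
Proof. exact: (@subset_closure (Topological.Pack s)). Qed.

Lemma topCl_minimal s A B : topOpen s (~` B) -> A `<=` B -> topCl s A `<=` B.
Proof.
move=> oCB sAB; apply: subsetC2; rewrite -topIntC.
by apply: topInt_maximal => //; apply: subsetC.
Qed.

Lemma topCl_closed s A : topOpen s (~` topCl s A).
Proof. by rewrite -topIntC; exact: topInt_open. Qed.

Lemma regopen_open s t A : pairwise_regopen s t A -> topOpen s A.
Proof. by move=> <-; exact: topInt_open. Qed.

(** The [t]-closure of [topInt s B] stays inside the [t]-closed set [B], so
    taking its [s]-interior gives nothing new. *)
Lemma regopen_int s t B :
  topOpen t (~` B) -> pairwise_regopen s t (topInt s B).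
Proof.
move=> cB; apply/seteqP; split.
  by apply: topIntS; apply: topCl_minimal => //; exact: topInt_subset.
by apply: topInt_maximal; [exact: topInt_open | exact: subset_topCl].
Qed.

Lemma regopen_int_cl s t A : pairwise_regopen s t (topInt s (topCl t A)).
Proof. by apply: regopen_int; exact: topCl_closed. Qed.

End explicit_interior_closure.

Section semiregularization_facts.
Context {X : Type}.
Implicit Types (s t : Topological X) (A U : set X).

Lemma regopen_semireg_open s t A :
  pairwise_regopen s t A -> topOpen (semireg s t) A.
Proof.
move=> rA; exists [set A]; last by rewrite bigcup_set1.
by move=> _ ->; exact: finI_from1.
Qed.

Lemma semireg_open_open s t A : topOpen (semireg s t) A -> topOpen s A.
Proof.
case=> F sF <-; apply: (@bigcup_open (Topological.Pack s)) => B /sF[G sG <-].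
rewrite bigcap_fset big_seq.
apply: (big_ind (topOpen s)) => [||C /sG].
- exact: (@openT (Topological.Pack s)).
- exact: (@openI (Topological.Pack s)).
- by rewrite inE => /regopen_open.
Qed.

(** The complement of [topCl t U] is [topInt t (~` U)], where [~` U] is
    [s]-closed: it is regular open, so [topCl t U] is closed for the coarser
    topology [semireg t s] too. *)
Lemma semireg_cl s t U : topOpen s U -> topCl (semireg t s) U = topCl t U.
Proof.
move=> oU; apply/seteqP; split.
  apply: topCl_minimal; last exact: subset_topCl.
  rewrite -topIntC; apply: regopen_semireg_open; apply: regopen_int.
  by rewrite setCK.
apply: topCl_minimal; last exact: subset_topCl.
by apply: (@semireg_open_open t s); exact: topCl_closed.
Qed.

Lemma semireg_int s t B :
  topOpen t (~` B) -> topInt (semireg s t) B = topInt s B.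
Proof.
move=> cB; apply/seteqP; split; apply: topInt_maximal; try exact: topInt_subset.
  by apply: (@semireg_open_open s t); exact: topInt_open.
by apply: regopen_semireg_open; exact: regopen_int.
Qed.

Lemma semireg_int_cl s t U : topOpen s U ->
  topInt (semireg s t) (topCl (semireg t s) U) = topInt s (topCl t U).
Proof.
by move=> oU; rewrite semireg_cl// semireg_int//; exact: topCl_closed.
Qed.

Lemma nearly_lindelof_semireg s t :
  nearly_lindelof s t <-> nearly_lindelof (semireg s t) (semireg t s).
Proof.
split=> nl I U oU covU.
  have oU' a : topOpen s (U a) := semireg_open_open (oU a).
  have [C [cC covC]] := nl I U oU' covU.
  exists C; split=> //; rewrite -covC.
  by apply: eq_bigcupr => a _; exact: semireg_int_cl.
pose V a := topInt s (topCl t (U a)).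
have rV a : pairwise_regopen s t (V a) := regopen_int_cl s t (U a).
have covV : \bigcup_a V a = [set: X].
  apply/seteqP; split=> // x _; have : [set: X] x by [].
  rewrite -covU => -[a _ Uax]; exists a => //.
  by apply: topInt_maximal Uax; [exact: oU | exact: subset_topCl].
have [C [cC covC]] := nl I V (fun a => regopen_semireg_open (rV a)) covV.
exists C; split=> //; rewrite -covC; apply: eq_bigcupr => a _.
by rewrite semireg_int_cl ?rV//; exact: regopen_open (rV a).
Qed.

End semiregularization_facts.

Theorem theorem4p2 (X : Type) (tau : 'I_2 -> Topological X) (i j : 'I_2)
    (hij : i != j) :
  nearly_lindelof (tau i) (tau j) <->
  nearly_lindelof (semireg (tau i) (tau j)) (semireg (tau j) (tau i)).
Proof. exact: nearly_lindelof_semireg. Qed.
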